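(* For any $k\geq 1$ and any constant $c\geq 1$, let $n=O(k^c)$ and let $\widehat{A}\sim\mathcal{A}(k,n)$. With positive probability, there is no algorithm able to output a matrix $B\in\mathbb{R}^{n\times(n+k)}$ lying in the row span of any $r=n/2$ rows of $\widehat{A}$ such that $$\|\widehat{A}-B\|_1\leq O(k^{0.5-\alpha})\min_{\mathrm{rank}\text{-}k\ A'}\|A'-\widehat{A}\|_1,$$ where $\alpha\in(0,0.5)$ is a constant which can be arbitrarily small.
   Context: $\mathcal{A}(k,n)$ denotes the distribution over $n\times(k+n)$ matrices whose first $n\times k$ block has i.i.d. standard Gaussian $N(0,1)$ entries and whose last $n\times n$ block is the identity matrix. $\|M\|_1=\sum_{i,j}|M_{i,j}|$ is the entrywise $\ell_1$ norm; the minimum is over all $n\times(k+n)$ matrices of rank at most $k$. *)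

(* Defs.v *)
From HB Require Import structures.
From mathcomp Require Export all_boot all_order all_algebra.
From mathcomp Require Export all_classical all_reals all_analysis.

Set Implicit Arguments.
Unset Strict Implicit.
Unset Printing Implicit Defensive.

Import Order.TTheory GRing.Theory Num.Theory.
Import numFieldNormedType.Exports.

Local Open Scope classical_set_scope.
Local Open Scope ring_scope.

Definition l1norm (R : realType) (m n : nat) (M : 'M[R]_(m, n)) : R :=
  \sum_(i < m) \sum_(j < n) `|M i j|.

(* The infimum is attained: the matrices of rank at most k form a nonempty
   closed set. *)
Definition opt_rank (R : realType) (k m n : nat) (A : 'M[R]_(m, n)) : R :=
  inf [set l1norm (A' - A) | A' in [set A' : 'M[R]_(m, n) | (\rank A' <= k)%N]].

Definition in_span_of_rows (R : realType) (r m n : nat) (A B : 'M[R]_(m, n)) :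
    Prop :=
  exists2 f : 'I_r -> 'I_m, injective f & (B <= rowsub f A)%MS.

Definition mutually_independent (R : realType) (d : measure_display)
    (T : measurableType d) (P : probability T R) (I : finType)
    (X : I -> {RV P >-> R}) : Prop :=
  forall (J : {set I}) (U : I -> set R), (forall i, measurable (U i)) ->
    P (\bigcap_(i in [set i | i \in J]) (X i @^-1` U i)) =
    (\prod_(i in J) P (X i @^-1` U i))%E.

Definition iid_std_gaussian (R : realType) (d : measure_display)
    (T : measurableType d) (P : probability T R) (I : finType)
    (X : I -> {RV P >-> R}) : Prop :=
  mutually_independent X /\
  forall i (U : set R), measurable U ->
    distribution P (X i) U = normal_prob 0 1 U.

(* The random matrix A, defined on the probability space (T, P), follows the
   distribution A(k, n). *)
Definition hard_distributed (R : realType) (d : measure_display)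
    (T : measurableType d) (P : probability T R) (k n : nat)
    (A : T -> 'M[R]_(n, k + n)) : Prop :=
  exists2 G : 'I_n * 'I_k -> {RV P >-> R}, iid_std_gaussian G &
    forall w, A w = row_mx (\matrix_(i < n, j < k) G (i, j) w) 1%:M.

(* An algorithm may be an arbitrary map, so "no algorithm outputs a good B"
   is the event that no good B exists.  For odd n, n/2 is rounded down. *)
Definition row_selection_fails (R : realType) (k n : nat) (rho : R) : Prop :=
  forall (d : measure_display) (T : measurableType d) (P : probability T R)
    (A : T -> 'M[R]_(n, k + n)),
  hard_distributed P A ->
  (0 < P [set w | ~ exists2 B : 'M[R]_(n, k + n),
                      in_span_of_rows n./2 (A w) B &
                      (l1norm (A w - B) <= rho * opt_rank k (A w))%R])%E.

(* Main.v *)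
Require Import Defs.
From mathcomp Require Import all_boot all_order all_algebra.
From mathcomp Require Import all_classical all_reals all_analysis.
From mathcomp Require Import lra ring zify.

(** Write [A = (H | I)]. The matrices [H] for which no good [B] exists form an
    open set, and a Gaussian matrix charges every nonempty open set, so a single
    bad [H] suffices. Take for [H] a sign matrix whose distinct rows have inner
    products at most [S = k^(1/2 + alpha/2)]; polynomially many such rows exist
    by a greedy choice and a Chernoff bound. If row [i] is not selected and is
    approximated with coefficients [x], then pairing the residual with row [i]
    of [H] gives [k <= (residual) + S * |x|_1], while the identity block costs
    at least [|x|_1]; hence each of the [n/2] unselected rows costs at least
    [k / S = k^(1/2 - alpha/2)]. On the other hand the optimum is at most [n]:
    replace the identity block by zero. For bounded [k] it is enough that each
    unselected row costs at least [1]. *)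

Set Implicit Arguments.
Unset Strict Implicit.
Unset Printing Implicit Defensive.

Import Order.TTheory GRing.Theory Num.Theory.
Import numFieldNormedType.Exports.
Local Open Scope classical_set_scope.
Local Open Scope ring_scope.

(** * Matrices of the form (H | I) *)

Lemma l1norm_ge0 (R : realType) m n (M : 'M[R]_(m, n)) : 0 <= l1norm M.
Proof. by apply: sumr_ge0 => i _; apply: sumr_ge0. Qed.

Lemma ler_l1normD (R : realType) m n (M N : 'M[R]_(m, n)) :
  l1norm (M + N) <= l1norm M + l1norm N.
Proof.
rewrite /l1norm -big_split; apply: ler_sum => i _ /=.
rewrite -big_split; apply: ler_sum => j _ /=.
by rewrite mxE ler_normD.
Qed.

Lemma l1norm_row_mx (R : realType) m n p (M : 'M[R]_(m, n)) (N : 'M[R]_(m, p)) :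
  l1norm (row_mx M N) = l1norm M + l1norm N.
Proof.
rewrite /l1norm -big_split; apply: eq_bigr => i _ /=.
rewrite big_split_ord; congr (_ + _); apply: eq_bigr => j _.
  by rewrite row_mxEl.
by rewrite row_mxEr.
Qed.

Lemma ler_l1norm_entry (R : realType) m n (M : 'M[R]_(m, n)) i j :
  `|M i j| <= l1norm M.
Proof.
rewrite /l1norm (bigD1 i) //= (bigD1 j) //= -addrA lerDl.
by rewrite addr_ge0 // sumr_ge0 // => i' _; apply: sumr_ge0.
Qed.

Lemma l1norm1 (R : realType) n : l1norm (1%:M : 'M[R]_n) = n%:R.
Proof.
rewrite /l1norm -[n in n%:R]card_ord -sumr_const; apply: eq_bigr => i _.
rewrite (bigD1 i) //= big1 => [|j ji]; last first.
  by rewrite mxE eq_sym (negbTE ji) normr0.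
by rewrite mxE eqxx normr1 addr0.
Qed.

Lemma opt_rank_le (R : realType) k m n (A A' : 'M[R]_(m, n)) :
  (\rank A' <= k)%N -> opt_rank k A <= l1norm (A' - A).
Proof.
move=> rA'; apply: ge_inf; last by exists A'.
by exists 0 => _ [B _ <-]; apply: l1norm_ge0.
Qed.

(** A competitor of rank at most [k] for [B] also competes for [A], at the price of a triangle
    inequality. This makes the optimum continuous in the matrix. *)
Lemma opt_rank_lipschitz (R : realType) k m n (A B : 'M[R]_(m, n)) :
  opt_rank k A <= opt_rank k B + l1norm (B - A).
Proof.
rewrite -lerBlDr; apply: lb_le_inf.
  by exists (l1norm (0 - B)), 0 => //=; rewrite mxrank0.
move=> _ [A' rA' <-]; rewrite lerBlDr.
apply: le_trans (ler_l1normD _ _); rewrite addrA subrK.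
exact: opt_rank_le.
Qed.

Lemma opt_rank_row_mx1_le (R : realType) k n (H : 'M[R]_(n, k)) :
  opt_rank k (row_mx H 1%:M) <= n%:R.
Proof.
have rH : (\rank (row_mx H (0 : 'M[R]_n)) <= k)%N.
  have -> : row_mx H (0 : 'M[R]_n) = H *m row_mx 1%:M 0.
    by rewrite mul_mx_row mulmx1 mulmx0.
  exact: leq_trans (mxrankM_maxr _ _) (rank_leq_row _).
apply: le_trans (opt_rank_le _ rH) _.
rewrite opp_row_mx add_row_mx subrr add0r l1norm_row_mx.
rewrite -[leRHS](@l1norm1 R n) /l1norm big1 ?add0r => [|i _]; last first.
  by rewrite big1 // => j _; rewrite mxE normr0.
by apply: ler_sum => i _; apply: ler_sum => j _; rewrite !mxE normrN.
Qed.

(** A matrix in the span of the rows selected by [f] is recorded by its coefficients [X], so that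
    the search for [B] becomes a search over a space of fixed dimension. *)
Definition span_cost (R : realType) (k n r : nat) (f : 'I_r -> 'I_n)
    (H : 'M[R]_(n, k)) (X : 'M[R]_(n, r)) : R :=
  l1norm (row_mx H 1%:M - X *m rowsub f (row_mx H 1%:M)).

Lemma span_costE (R : realType) k n r (f : 'I_r -> 'I_n)
    (H : 'M[R]_(n, k)) (X : 'M[R]_(n, r)) :
  span_cost f H X =
  l1norm (H - X *m rowsub f H) + l1norm (1%:M - X *m rowsub f 1%:M).
Proof.
rewrite /span_cost.
have -> : rowsub f (row_mx H 1%:M) = row_mx (rowsub f H) (rowsub f 1%:M).
  apply/matrixP => i j; rewrite [LHS]mxE [LHS]mxE [RHS]mxE.
  by case: fintype.split => a; rewrite [RHS]mxE.
by rewrite mul_mx_row opp_row_mx add_row_mx l1norm_row_mx.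
Qed.

Lemma mulmx_rowsub1 (R : realType) n r (f : 'I_r -> 'I_n) (X : 'M[R]_(n, r))
    i a : injective f -> (X *m rowsub f 1%:M) i (f a) = X i a.
Proof.
move=> injf; rewrite mxE (bigD1 a) //= big1 => [|b ba].
  by rewrite !mxE eqxx mulr1 addr0.
by rewrite !mxE (inj_eq injf) (negbTE ba) mulr0.
Qed.

Lemma mulmx_rowsub1_out (R : realType) n r (f : 'I_r -> 'I_n)
    (X : 'M[R]_(n, r)) i j :
  (forall a, f a != j) -> (X *m rowsub f 1%:M) i j = 0.
Proof.
by move=> jf; rewrite mxE big1 // => a _; rewrite !mxE (negbTE (jf a)) mulr0.
Qed.

(** Column [f a] of the identity block of the residual contains [X i a] up to sign and a shift by 0
    or 1, so a cheap approximation has bounded coefficients. *)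
Lemma span_cost_coef (R : realType) k n r (f : 'I_r -> 'I_n)
    (H : 'M[R]_(n, k)) (X : 'M[R]_(n, r)) i a :
  injective f -> `|X i a| <= 1 + span_cost f H X.
Proof.
move=> injf; rewrite span_costE.
have := ler_l1norm_entry (1%:M - X *m rowsub f 1%:M) i (f a).
rewrite [X in `|X|]mxE [X in _ + X]mxE mulmx_rowsub1 // mxE.
set b := _ *+ _ => le1.
have b1 : `|b| <= 1 by rewrite /b; case: (i == _); rewrite ?normr1 ?normr0.
have := l1norm_ge0 (H - X *m rowsub f H).
have : `|X i a| <= `|b| + `|b - X i a|.
  by rewrite -{1}(subrK b (X i a)) distrC addrC; apply: ler_normD.
lra.
Qed.

Lemma in_span_of_rowsP (R : realType) k n r (H : 'M[R]_(n, k)) (t : R) :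
  (exists2 B, in_span_of_rows r (row_mx H 1%:M) B &
     l1norm (row_mx H 1%:M - B) <= t) <->
  (exists2 f : 'I_r -> 'I_n, injective f & exists X, span_cost f H X <= t).
Proof.
split=> [[B [f injf /submxP[X ->]] le_t]|[f injf [X le_t]]].
  by exists f => //; exists X.
by exists (X *m rowsub f (row_mx H 1%:M)) => //; exists f => //; apply: submxMl.
Qed.

(** * Openness of the failure set *)

Lemma cvg_l1norm (R : realType) m n (T : Type) (F : set_system T)
    {FF : Filter F} (M : T -> 'M[R]_(m, n)) (L : 'M[R]_(m, n)) :
  (forall i j, M x i j @[x --> F] --> L i j) ->
  l1norm (M x) @[x --> F] --> l1norm L.
Proof.
move=> cM; apply: cvg_big => [|i _]; first exact: add_continuous.
apply: cvg_big => [|j _]; first exact: add_continuous.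
by apply: cvg_norm; exact: cM.
Qed.

Lemma opt_rank_row_mx1_continuous (R : realType) k n :
  continuous (fun H : 'M[R]_(n, k) => opt_rank k (row_mx H (1%:M : 'M[R]_n))).
Proof.
move=> H; set g := fun H' : 'M[R]_(n, k) => l1norm (H - H').
have g0 : g H' @[H' --> H] --> 0.
  have -> : 0 = l1norm (H - H).
    rewrite subrr /l1norm big1 // => i _; rewrite big1 // => j _.
    by rewrite mxE normr0.
  apply: (cvg_l1norm (F := nbhs H)) => i j; rewrite !mxE.
  under eq_cvg do rewrite !mxE.
  by apply: cvgB; [exact: cvg_cst|exact: coord_continuous].
have dist_row (H1 H2 : 'M[R]_(n, k)) :
    l1norm (row_mx H1 (1%:M : 'M[R]_n) - row_mx H2 1%:M) = l1norm (H1 - H2).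
  rewrite opp_row_mx add_row_mx l1norm_row_mx subrr -[RHS]addr0; congr (_ + _).
  by rewrite /l1norm big1 // => i _; rewrite big1 // => j _; rewrite mxE normr0.
set o := fun H : 'M[R]_(n, k) => opt_rank k (row_mx H (1%:M : 'M[R]_n)).
(* The Lipschitz bound, used in both directions, squeezes the optimum at [H'] between [o H - g H']
   and [o H + g H']. *)
apply: (@squeeze_cvgr _ (nbhs H) _ _ (fun H' => o H - g H')
  (fun H' => o H + g H')).
- apply: nearW => H'.
  have := opt_rank_lipschitz k (row_mx H (1%:M : 'M[R]_n)) (row_mx H' 1%:M).
  have := opt_rank_lipschitz k (row_mx H' (1%:M : 'M[R]_n)) (row_mx H 1%:M).
  rewrite !dist_row /o /g lerBlDr => -> /=.
  suff -> : l1norm (H' - H) = l1norm (H - H') by move=> ->.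
  rewrite /l1norm; apply: eq_bigr => i _; apply: eq_bigr => j _.
  by rewrite !mxE distrC.
- by rewrite -[X in _ --> X]subr0; apply: cvgB => //; exact: cvg_cst.
- by rewrite -[X in _ --> X]addr0; apply: cvgD => //; exact: cvg_cst.
Qed.

Lemma cvg_span_cost (R : realType) k n r (f : 'I_r -> 'I_n) (T : Type)
    (F : set_system T) {FF : Filter F} (Ht : T -> 'M[R]_(n, k))
    (Xt : T -> 'M[R]_(n, r))
    (H : 'M[R]_(n, k)) (X : 'M[R]_(n, r)) :
  (forall i j, Ht x i j @[x --> F] --> H i j) ->
  (forall i j, Xt x i j @[x --> F] --> X i j) ->
  span_cost f (Ht x) (Xt x) @[x --> F] --> span_cost f H X.
Proof.
move=> cvgH cvgX.
have cvgHI i j : row_mx (Ht x) (1%:M : 'M[R]_n) i j @[x --> F] -->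
    row_mx H (1%:M : 'M[R]_n) i j.
  rewrite mxE; under eq_cvg do rewrite mxE.
  by case: fintype.split => a; [exact: cvgH|exact: cvg_cst].
apply: cvg_l1norm => i j; rewrite mxE; under eq_cvg do rewrite mxE.
apply: cvgD; first exact: cvgHI.
rewrite mxE; under eq_cvg do rewrite mxE; apply: cvgN.
rewrite mxE; under eq_cvg do rewrite mxE.
apply: cvg_big => [|a _]; first exact: add_continuous.
apply: cvgM; first exact: cvgX.
by rewrite mxE; under eq_cvg do rewrite mxE; exact: cvgHI.
Qed.

(** The failure event as a condition on the Gaussian block [H] alone, so that it can be studied
    topologically. *)
Definition no_good_span (R : realType) (k n r : nat) (rho : R) :
    set 'M[R]_(n, k) :=
  [set H | ~ exists2 B, in_span_of_rows r (row_mx H 1%:M) B &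
     l1norm (row_mx H 1%:M - B) <= rho * opt_rank k (row_mx H 1%:M)].

(* Coefficients of size more than 1 + rho n cost more than rho n >= rho opt,
   so only a compact box of coefficient matrices matters near any H. *)
Lemma open_no_good_span (R : realType) k n r (rho : R) :
  0 <= rho -> open (@no_good_span R k n r rho).
Proof.
move=> rho0; rewrite openE => H WH; rewrite /interior.
set o := fun H : 'M[R]_(n, k) => opt_rank k (row_mx H (1%:M : 'M[R]_n)).
have pos (f : 'I_r -> 'I_n) X : injective f -> rho * o H < span_cost f H X.
  move=> injf; rewrite ltNge; apply/negP => le_rho; apply: WH.
  by apply/in_span_of_rowsP; exists f => //; exists X.
pose b := 1 + rho * n%:R.
(* Coefficient matrices are flattened to row vectors, where the box is a product of segments. *)
pose K : set 'rV[R]_(n * r) := [set v | forall i, `[- b, b]%classic (v ord0 i)].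
have cK : compact K.
  apply: (@rV_compact _ _ (fun=> `[- b, b]%classic)) => i.
  exact: segment_compact.
(* Selections are taken as finite functions: there are finitely many, so their neighbourhoods of [H]
   can be intersected at the end. *)
have nearf (f : {ffun 'I_r -> 'I_n}) : \forall H' \near H, injective f ->
    K `<=` [set v | rho * o H' < span_cost f H' (vec_mx v)].
  have [injf|ninjf] := pselect (injective f); last first.
    by apply: (@nearW _ (nbhs H)) => H' /ninjf.
  suff : \forall H' \near H,
      K `<=` [set v | rho * o H' < span_cost f H' (vec_mx v)].
    by apply: (@filterS _ (nbhs H)) => H' ? _.
  (* Tube argument: by joint continuity the strict inequality survives near each pair [(v, H)], and
     compactness of [K] gives one neighbourhood of [H] valid for all [v] in [K]. *)
  have /compact_near_coveringP nK := cK; apply: (nK _ (nbhs H)) => v Kv.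
  have : (fun p : 'rV[R]_(n * r) * 'M[R]_(n, k) =>
      span_cost f p.2 (vec_mx p.1) - rho * o p.2) @ (nbhs v, nbhs H) -->
      span_cost f H (vec_mx v) - rho * o H.
    apply: cvgB.
      apply: cvg_span_cost => i j.
        by apply: (@cvg_comp _ _ _ snd (fun M : 'M[R]_(n, k) => M i j) _
            (nbhs H));
          [exact: cvg_snd|exact: coord_continuous].
      rewrite mxE; under eq_cvg do rewrite mxE.
      by apply: (@cvg_comp _ _ _ fst
          (fun v : 'rV[R]_(n * r) => v ord0 (mxvec_index i j)) _ (nbhs v));
          [exact: cvg_fst|exact: coord_continuous].
    apply: cvgM; first exact: cvg_cst.
    by apply: (@cvg_comp _ _ _ snd o _ (nbhs H));
      [exact: cvg_snd|exact: opt_rank_row_mx1_continuous].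
  move/cvgr_gt => /(_ 0); rewrite subr_gt0 => /(_ (pos _ _ injf)).
  by apply: filterS => -[v' H'] /=; rewrite subr_gt0.
apply: filterS (filter_forall (nbhs_filter H) nearf) => H' WH'.
case/in_span_of_rowsP => f injf [X costX].
have finj : injective (finfun f) by move=> x y; rewrite !ffunE => /injf.
have eqf : span_cost (finfun f) H' X = span_cost f H' X.
  congr (l1norm (_ - _ *m _)); apply/matrixP => i j.
  by rewrite [LHS]mxE [RHS]mxE ffunE.
have KX : K (mxvec X).
  move=> j; case/mxvec_indexP: j => i a; rewrite mxvecE /= in_itv /= -ler_norml.
  apply: le_trans (span_cost_coef H' X i a injf) _; rewrite lerD2l.
  apply: le_trans costX _; apply: ler_wpM2l => //; exact: opt_rank_row_mx1_le.
have := WH' _ finj _ KX; rewrite /= mxvecK eqf.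
by rewrite ltNge costX.
Qed.

(** * Gaussian measure of open sets *)

Lemma normal_prob_itv_gt0 (R : realType) (a e : R) :
  0 < e -> (0 < normal_prob 0 1 [set` `]a - e, a + e[%R])%E.
Proof.
move=> e0; set D := (X in normal_prob _ _ X).
have mD : measurable (D : set R) by exact: measurable_itv.
(* Every point of the interval has absolute value at most [b], so the density there is at least its
   value [c] at [b]. *)
pose b := `|a| + e; pose c : R := normal_peak 1 * expR (- (b ^+ 2 / 2)).
have peak0 : 0 < normal_peak 1 :> R.
  by apply: normal_peak_gt0; rewrite oner_neq0.
have c0 : 0 < c by rewrite mulr_gt0 // expR_gt0.
have le_c x : D x -> c <= normal_pdf 0 1 x.
  rewrite /D /= in_itv /= => /andP[x1 x2].
  rewrite normal_pdfE ?oner_neq0 //=.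
  rewrite /normal_fun /c.
  rewrite ler_pM2l // ler_expR subr0 expr1n mulNr lerN2 -[1 *+ 2]/(2%:R).
  rewrite ler_pM2r ?invr_gt0 // -(real_normK (num_real x)).
  have xb : `|x| <= b.
    have := ler_norm a; have := ler_norm (- a); rewrite normrN => ? ?.
    by rewrite ler_norml /b; lra.
  by rewrite lerXn2r // nnegrE (le_trans _ xb).
rewrite /normal_prob.
apply: (@lt_le_trans _ _ (\int[lebesgue_measure]_(x in D) cst c%:E x)%E).
  rewrite integral_cst //=.
  have -> : lebesgue_measure D = (a + e - (a - e))%:E.
    rewrite [LHS]lebesgue_measure_itv /= lte_fin ifT //; lra.
  by rewrite -EFinM lte_fin mulr_gt0 //; lra.
apply: ge0_le_integral => //=.
  by move=> x _; rewrite lee_fin ltW.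
apply/measurable_realfun.measurable_EFinP; apply: measurable_funTS.
exact: measurable_normal_pdf.
Qed.

(** An open set of matrices is the union of the countably many rational boxes it contains, and the
    preimage of a box is a finite intersection of measurable sets. *)
Lemma measurable_open_mx (R : realType) (d : measure_display)
    (T : measurableType d) n k (G : 'I_n * 'I_k -> T -> R)
    (W : set 'M[R]_(n, k)) :
  (forall p, measurable_fun setT (G p)) -> open W ->
  measurable [set w | W (\matrix_(i, j) G (i, j) w)].
Proof.
move=> mG oW.
pose box (Q : 'M[rat]_(n, k)) (m : rat) (p : 'I_n * 'I_k) : set R :=
  `]ratr (Q p.1 p.2) - ratr m, ratr (Q p.1 p.2) + ratr m[%classic.
pose inside (z : 'M[rat]_(n, k) * rat) :=
  forall N : 'M[R]_(n, k), (forall p, box z.1 z.2 p (N p.1 p.2)) -> W N.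
pose F (z : 'M[rat]_(n, k) * rat) : set T :=
  if `[< inside z >] then \bigcap_p (G p @^-1` box z.1 z.2 p) else set0.
have -> : [set w | W (\matrix_(i, j) G (i, j) w)] = \bigcup_z F z.
  apply/seteqP; split=> [w|w [[Q m] _]]; last first.
    rewrite /F; case: asboolP => // inW Gw; apply: inW => p.
    by rewrite mxE -surjective_pairing; exact: Gw.
  rewrite /=; set M := (X in W X) => WM.
  have /nbhs_ballP[e /= e0 eW] : nbhs M W by exact: open_nbhs_nbhs.
  (* A box of radius [m] whose centre is within [m] of [M] stays within [2 * m < e] of [M], hence
     inside [W]. *)
  have [|m] := @rat_in_itvoo R 0 (e / 2); first by rewrite divr_gt0.
  rewrite in_itv /= => /andP[m0 me].
  have exq i j : {q : rat | `|ratr q - M i j| < ratr m}.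
    apply: cid; have [|q] := @rat_in_itvoo R (M i j - ratr m) (M i j + ratr m).
      by lra.
    by rewrite in_itv /= => /andP[? ?]; exists q; rewrite ltr_norml; lra.
  pose Q : 'M[rat]_(n, k) := \matrix_(i, j) sval (exq i j).
  have QM i j : `|ratr (Q i j) - M i j| < ratr m.
    by rewrite [Q i j]mxE; exact: (svalP (exq i j)).
  exists (Q, m) => //; rewrite /F.
  have -> : `[< inside (Q, m) >].
    apply/asboolP => N /= boxN; apply: eW; split=> // i j.
    have := boxN (i, j); rewrite /box /= in_itv /=.
    have := QM i j; rewrite ltr_norml /ball /= => /andP[? ?] /andP[? ?].
    by rewrite ltr_norml; lra.
  move=> [i j] _; rewrite /box /= in_itv /=.
  by have := QM i j; rewrite [M i j]mxE ltr_norml => /andP[? ?]; lra.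
apply: countable_bigcupT_measurable => [|z]; first exact: countableP.
rewrite /F; case: asboolP => // _.
apply: fin_bigcap_measurable => [|p _]; first exact: finite_finset.
by rewrite -[_ @^-1` _]setTI; apply: mG => //; exact: measurable_itv.
Qed.

(** [W] contains a ball for the entrywise maximum distance, which is a product of intervals;
    independence turns its probability into a finite product of positive factors. *)
Lemma gaussian_open_gt0 (R : realType) (d : measure_display)
    (T : measurableType d) (P : probability T R) n k
    (G : 'I_n * 'I_k -> {RV P >-> R}) (W : set 'M[R]_(n, k)) :
  iid_std_gaussian G -> open W -> W !=set0 ->
  (0 < P [set w | W (\matrix_(i, j) G (i, j) w)])%E.
Proof.
move=> [indG gaussG] oW [M WM].
have /nbhs_ballP[e /= e0 eW] : nbhs M W by exact: open_nbhs_nbhs.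
pose U (p : 'I_n * 'I_k) : set R := `]M p.1 p.2 - e, M p.1 p.2 + e[%classic.
have mU p : measurable (U p) by exact: measurable_itv.
have mG p : measurable (G p @^-1` U p).
  by rewrite -[_ @^-1` _]setTI; exact: measurable_funP.
apply: (@lt_le_trans _ _
  (P (\bigcap_(p in [set p | p \in [set: 'I_n * 'I_k]%SET]) (G p @^-1` U p)))).
  rewrite indG //; apply: (big_ind (fun x : \bar R => (0 < x)%E)) => [|x y|p _];
    [by []|exact: mule_gt0|].
  by have /= := gaussG p _ (mU p); rewrite /distribution /pushforward => ->;
    exact: normal_prob_itv_gt0.
apply: le_measure.
- by rewrite inE; apply: fin_bigcap_measurable => //; exact: finite_finset.
- rewrite inE; apply: (measurable_open_mx (G := G)) => // p;
    exact: measurable_funP.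
- move=> w Uw; apply: eW; split=> // i j; rewrite mxE /ball /=.
  have := Uw (i, j) (finset.in_setT _); rewrite /U /= in_itv /= => /andP[? ?].
  by rewrite ltr_norml; lra.
Qed.

(** Since the optimum is at most [n], the hypothesis puts [H] in the open failure set, which
    therefore has positive probability. *)
Lemma row_selection_fails_witness (R : realType) k n (rho : R)
    (H : 'M[R]_(n, k)) : 0 <= rho ->
  (forall (f : 'I_n./2 -> 'I_n) X, injective f ->
     rho * n%:R < span_cost f H X) ->
  row_selection_fails k n rho.
Proof.
move=> rho0 costH d T P A [G iidG AE].
under eq_set do rewrite AE.
apply: (gaussian_open_gt0 iidG (open_no_good_span (r := n./2) rho0)).
exists H => /in_span_of_rowsP[f injf [X]]; apply/negP; rewrite -ltNge.
apply: le_lt_trans (costH f X injf).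
by rewrite ler_wpM2l // opt_rank_row_mx1_le.
Qed.

(** * Lower bounds on the approximation cost *)

(** In an unselected row [i] the diagonal entry of the residual stays 1, and the columns [f a],
    distinct from each other and from [i], carry the entries [- X i a]. *)
Lemma identity_row_cost (R : realType) n r (f : 'I_r -> 'I_n)
    (X : 'M[R]_(n, r)) i : injective f -> (forall a, f a != i) ->
  1 + \sum_a `|X i a| <= \sum_j `|(1%:M - X *m rowsub f 1%:M) i j|.
Proof.
move=> injf fi; rewrite (bigD1 i) //=; apply: lerD.
  by rewrite mxE [X in _ + X]mxE mulmx_rowsub1_out // mxE eqxx subr0 normr1.
have subi j : j \in [set f a | a : 'I_r]%SET -> j != i.
  by case/imsetP => a _ ->.
rewrite (bigID (mem [set f a | a : 'I_r]%SET)) /=.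
rewrite -[leLHS]addr0; apply: lerD; last exact: sumr_ge0.
rewrite (eq_bigl (mem [set f a | a : 'I_r]%SET)) => [|j]; last first.
  by rewrite /=; case: (boolP (j \in _)) => [/subi ->|]; rewrite ?andbF.
rewrite (big_imset (fun j => `|(1%:M - X *m rowsub f 1%:M) i j|)) /=;
    last first.
  by move=> a b _ _; exact: injf.
apply: ler_sum => a _; rewrite [X in _ <= `|X|]mxE [X in _ + X]mxE.
by rewrite mulmx_rowsub1 // mxE eq_sym (negbTE (fi a)) sub0r normrN.
Qed.

Lemma span_cost_ge (R : realType) k n (f : 'I_n./2 -> 'I_n)
    (H : 'M[R]_(n, k)) (X : 'M[R]_(n, n./2)) (t : R) : 0 <= t -> injective f ->
  (forall i, (forall a, f a != i) ->
     t <= \sum_j `|(H - X *m rowsub f H) i j| + (1 + \sum_a `|X i a|)) ->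
  n%:R / 2 * t <= span_cost f H X.
Proof.
move=> t0 injf rowt; rewrite span_costE /l1norm -big_split /=.
rewrite (bigID (mem (codom f))) /= -[leLHS]add0r; apply: lerD.
  by apply: sumr_ge0 => i _; apply: addr_ge0; exact: sumr_ge0.
apply: (@le_trans _ _ (\sum_(i | i \notin codom f) t)).
  (* The number of unselected rows is [n - n./2], which is at least [n / 2] for odd [n] as well
     because [n./2] rounds down. *)
  rewrite sumr_const -[leRHS]mulr_natl ler_wpM2r //.
  have := cardC (mem (codom f)); rewrite card_codom // !card_ord => card_out.
  rewrite ler_pdivrMr // -natrM ler_nat.
  have -> : #|[pred i | i \notin codom f]| = #|[predC mem (codom f)]|.
    exact: eq_card.
  move: card_out; move: #|_| => m nm.
  have := odd_double_half n; rewrite -addnn; move: nm; clear.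
  move: n./2 (odd n) => h b.
  by case: b => /=; lia.
apply: ler_sum => i; rewrite -[X in ~~ X]/(i \in codom f) => /codomP fi.
have fi' a : f a != i by apply/eqP => fai; apply: fi; exists a.
apply: le_trans (rowt i fi') _; rewrite lerD2l; exact: identity_row_cost.
Qed.

(* Pair row i of the residual with row i of H. *)
Lemma incoherent_row_cost (R : realType) k n r (f : 'I_r -> 'I_n)
    (H : 'M[R]_(n, k)) (X : 'M[R]_(n, r)) (S : R) i :
  1 <= S -> (forall i j, `|H i j| = 1) ->
  (forall i' : 'I_n, i != i' -> `|\sum_j H i j * H i' j| <= S) ->
  (forall a, f a != i) ->
  k%:R / S <= \sum_j `|(H - X *m rowsub f H) i j| + (1 + \sum_a `|X i a|).
Proof.
move=> S1 H1 HS fi; have S0 : 0 < S by apply: lt_le_trans S1.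
rewrite ler_pdivrMr //.
(* The squared norm of the sign row [i] is [k]; row [i] is then split into its residual and its
   approximation by selected rows. *)
have -> : k%:R = \sum_j H i j * (H - X *m rowsub f H) i j +
    \sum_a X i a * \sum_j H i j * H (f a) j.
  have -> : \sum_a X i a * \sum_j H i j * H (f a) j =
      \sum_j H i j * (X *m rowsub f H) i j.
    under eq_bigr do rewrite mulr_sumr.
    rewrite exchange_big; apply: eq_bigr => j _ /=.
    rewrite mxE mulr_sumr; apply: eq_bigr => a _.
    by rewrite mxE mulrCA.
  rewrite -big_split /= -[k in LHS]card_ord -sumr_const; apply: eq_bigr => j _.
  rewrite -mulrDr [(H - _) i j]mxE [X in _ + X + _]mxE subrK.
  by rewrite -expr2 -real_normK ?num_real // H1 expr1n.
apply: (@le_trans _ _ (\sum_j `|(H - X *m rowsub f H) i j| +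
    (\sum_a `|X i a|) * S)).
  apply: lerD.
    apply: ler_sum => j _; apply: le_trans (ler_norm _) _.
    by rewrite normrM H1 mul1r.
  rewrite mulr_suml; apply: ler_sum => a _; apply: le_trans (ler_norm _) _.
  by rewrite normrM ler_wpM2l // HS // eq_sym.
set p := \sum_j _; set q := \sum_a _.
have p0 : 0 <= p by exact: sumr_ge0.
have q0 : 0 <= q by exact: sumr_ge0.
(* The residual part is enlarged by the factor [S >= 1], and the leftover 1 is added to [q]. *)
rewrite mulrDl; apply: lerD; first by rewrite ler_peMr.
by apply: ler_wpM2r; [exact: ltW|rewrite lerDr].
Qed.

(** Elements are chosen one at a time: those already chosen rule out at most [B] candidates each,
    fewer than [#|T|] altogether. *)
Lemma greedy_avoid (R : realType) (T : finType) (bad : rel T) (B : R)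
    (n : nat) :
  0 <= B -> symmetric bad -> (forall u, #|[pred s | bad s u]|%:R <= B) ->
  n%:R * B < #|T|%:R ->
  exists v : nat -> T, forall i j, (i < n)%N -> (j < n)%N -> i != j ->
    ~~ bad (v i) (v j).
Proof.
move=> B0 bad_sym badB; elim: n => [|n IHn] ltB.
  (* [v] is a total function, so even the empty choice needs some element of [T] as a default
     value. *)
  have : (0 < #|T|)%N by rewrite -(ltr_nat R) (le_lt_trans _ ltB) // mul0r.
  by case/card_gt0P => x _; exists (fun=> x).
have [|v vP] := IHn.
  by apply: le_lt_trans ltB; rewrite ler_wpM2r ?ler_nat //.
have [x xP] : exists x, forall i : 'I_n, ~~ bad x (v i).
  apply: contrapT => nx; move: ltB; rewrite ltNge => /negP; apply.
  have cover x : exists i : 'I_n, bad x (v i).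
    apply: contrapT => ni; apply: nx; exists x => i; apply/negP => bxi.
    by apply: ni; exists i.
  apply: (@le_trans _ _ (\sum_(i < n) #|[pred s | bad s (v i)]|%:R));
      last first.
    apply: (@le_trans _ _ (\sum_(i < n) B)); first exact: ler_sum.
    by rewrite sumr_const card_ord -[leLHS]mulr_natl ler_wpM2r ?ler_nat.
  rewrite -natr_sum ler_nat.
  (* Double counting: if every [x] were ruled out by some [v i], the excluded sets would cover
     [T]. *)
  have -> : #|T| = \sum_(x : T) 1 by rewrite sum1_card.
  under eq_bigr do rewrite -sum1_card big_mkcond.
  rewrite exchange_big; apply: leq_sum => x _.
  have [i bxi] := cover x.
  by rewrite (bigD1 i) //= inE bxi.
exists (fun i => if i == n then x else v i) => i j.
rewrite !ltnS [(i <= n)%N]leq_eqVlt [(j <= n)%N]leq_eqVlt.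
move=> /orP[/eqP ->|ltin] /orP[/eqP ->|ltjn].
- by rewrite eqxx.
- by move=> _; rewrite eqxx (ltn_eqF ltjn); exact: (xP (Ordinal ltjn)).
- move=> _; rewrite eqxx (ltn_eqF ltin) bad_sym; exact: (xP (Ordinal ltin)).
- by move=> ij; rewrite (ltn_eqF ltin) (ltn_eqF ltjn); exact: vP.
Qed.

(** * Incoherent sign matrices *)

Lemma bernoulli_le (R : realType) (x : R) n :
  0 <= x <= 1 -> 1 - n%:R * x <= (1 - x) ^+ n.
Proof.
move=> /andP[x0 x1]; elim: n => [|n IHn]; first by rewrite expr0 mul0r subr0.
rewrite exprS -natr1 mulrDl mul1r.
have : 0 <= (1 - x) * ((1 - x) ^+ n - (1 - n%:R * x)).
  by rewrite mulr_ge0 // subr_ge0.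
have : 0 <= n%:R * x * x by rewrite !mulr_ge0.
move: (n%:R) => m; nra.
Qed.

(** Inverting [1 - s <= expR (- s)] bounds [expR s] by [(1 - s)^-1]; the right-hand side is the sum
    of these bounds at [t] and [- t]. *)
Lemma expR_cosh_le (R : realType) (t : R) :
  `|t| < 1 -> expR t + expR (- t) <= 2 / (1 - t ^+ 2).
Proof.
rewrite ltr_norml => /andP[t1 t2].
have expN (s : R) : - 1 < s -> s < 1 -> expR s <= (1 - s)^-1.
  move=> s1 s2; rewrite -[s in expR s]opprK expRN.
  rewrite lef_pV2 ?posrE ?expR_gt0 ?subr_gt0 //.
  exact: expR_ge1Dx.
have := expN t t1 t2; have := expN (- t).
rewrite opprK ltrN2 => /(_ t2); rewrite ltrNl => /(_ t1) h1 h2.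
apply: le_trans (lerD h2 h1) _.
suff -> : (1 - t)^-1 + (1 + t)^-1 = 2 / (1 - t ^+ 2) by [].
by field; apply/and3P; split; apply: lt0r_neq0; nra.
Qed.

(** Sign vectors are encoded by boolean functions, a finite type in which they can be counted. *)
Definition sign_dot (R : realType) (k : nat) (s u : {ffun 'I_k -> bool}) : R :=
  \sum_j (-1) ^+ s j * (-1) ^+ u j.

(** The exponential of the sum factors over coordinates, and each coordinate contributes the same
    two terms whatever the sign of [u j]. *)
Lemma sum_expR_sign_dot (R : realType) k (t : R) (u : {ffun 'I_k -> bool}) :
  \sum_s expR (t * sign_dot R s u) = (expR t + expR (- t)) ^+ k.
Proof.
pose F (j : 'I_k) (b : bool) : R := expR (t * ((-1) ^+ b * (-1) ^+ u j)).
transitivity (\sum_(s : {ffun 'I_k -> bool}) \prod_j F j (s j)).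
  by apply: eq_bigr => s _; rewrite /sign_dot mulr_sumr expR_sum.
rewrite -(bigA_distr_bigA F) -[k in RHS]card_ord -prodr_const.
apply: eq_bigr => j _; rewrite big_bool /F /=.
by case: (u j); rewrite ?expr0 ?expr1 ?mulr1 ?mulrNN ?mulr1 ?mulrN1 // addrC.
Qed.

(* Chernoff bound: for t of order 1 / sqrt k, the moment generating function of
   a sum of k random signs is at most 2. *)
Lemma card_sign_dot_large (R : realType) k (S t : R) (u : {ffun 'I_k -> bool}) :
  0 <= t -> t ^+ 2 * k%:R * 2 <= 1 -> t < 1 ->
  #|[pred s : {ffun 'I_k -> bool} | S < `|sign_dot R s u|]|%:R <=
  4 * 2 ^+ k / expR (t * S).
Proof.
move=> t0 tk t1; rewrite ler_pdivlMr ?expR_gt0 //.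
(* Markov's inequality for both tails at once: whatever the sign of the inner product, one of the
   two exponentials is at least [expR (t * S)] on the large set. *)
apply: (@le_trans _ _ (\sum_(s : {ffun 'I_k -> bool})
   (expR (t * sign_dot R s u) + expR (- t * sign_dot R s u)))).
  rewrite (bigID [pred s | S < `|sign_dot R s u|]) /= -[leLHS]addr0.
  apply: lerD; last by apply: sumr_ge0 => s _; rewrite addr_ge0 ?expR_ge0.
  rewrite -sum1_card natr_sum mulr_suml; apply: ler_sum => s.
  rewrite !inE mul1r => Ss.
  apply: (@le_trans _ _ (expR (t * `|sign_dot R s u|))).
    by rewrite ler_expR ler_wpM2l // ltW.
  have [x0|x0] := leP 0 (sign_dot R s u).
    by rewrite ger0_norm // lerDl expR_ge0.
  by rewrite ltr0_norm // mulrN mulNr lerDr expR_ge0.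
rewrite big_split /= !sum_expR_sign_dot opprK [expR (- t) + _]addrC.
have le2 : (expR t + expR (- t)) ^+ k <= 2 * 2 ^+ k.
  have t2 : 0 <= t ^+ 2 < 1 by rewrite exprn_ge0 // expr_lt1.
  have ct : 0 < 1 - t ^+ 2 by rewrite subr_gt0; case/andP: t2.
  apply: (@le_trans _ _ ((2 / (1 - t ^+ 2)) ^+ k)).
    rewrite lerXn2r ?nnegrE ?addr_ge0 ?expR_ge0 ?divr_ge0 // ?(ltW ct) //.
    by apply: expR_cosh_le; rewrite ger0_norm.
  rewrite expr_div_n ler_pdivrMr ?exprn_gt0 //.
  (* Bernoulli's inequality and [t ^+ 2 * k <= 1/2] keep [(1 - t ^+ 2) ^+ k] above 1/2. *)
  have := @bernoulli_le R (t ^+ 2) k.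
  case/andP: t2 => -> /ltW -> => /(_ isT) hb.
  have : 2^-1 <= (1 - t ^+ 2) ^+ k by move: tk hb; rewrite [k%:R * _]mulrC; lra.
  have : 0 < 2 ^+ k :> R by rewrite exprn_gt0.
  by nra.
lra.
Qed.

(** Greedy choice among the [2 ^+ k] sign vectors, two being incompatible when their inner product
    exceeds [S]. The Chernoff parameter is [t = 1 / (2 sqrt k)], for which [t ^+ 2 * k = 1/4]. *)
Lemma incoherent_signs (R : realType) k n (S : R) : (0 < k)%N ->
  4 * n%:R < expR (S / (2 * Num.sqrt k%:R)) ->
  exists2 H : 'M[R]_(n, k), forall i j, `|H i j| = 1 &
    forall i i', i != i' -> `|\sum_j H i j * H i' j| <= S.
Proof.
move=> k0; set t := (2 * Num.sqrt k%:R)^-1 => nS.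
have sk : 1 <= Num.sqrt k%:R :> R by rewrite -[leLHS]sqrtr1 ler_wsqrtr // ler1n.
have sk2 : Num.sqrt k%:R ^+ 2 = k%:R :> R by rewrite sqr_sqrtr.
pose bad := [rel s u : {ffun 'I_k -> bool} | S < `|sign_dot R s u|].
have badC : symmetric bad.
  move=> s u; rewrite /bad /= /sign_dot; congr (_ < `|_|).
  by apply: eq_bigr => j _; rewrite mulrC.
have t0 : 0 < t by rewrite invr_gt0; lra.
have [||||v vP] := @greedy_avoid R _ bad (4 * 2 ^+ k / expR (t * S)) n.
- by rewrite divr_ge0 ?mulr_ge0 ?exprn_ge0 ?expR_ge0.
- exact: badC.
- move=> u; apply: card_sign_dot_large; first exact: ltW.
    rewrite /t exprVn exprMn sk2.
    have k1 : 0 < k%:R :> R by rewrite ltr0n.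
    have -> : (2 ^+ 2 * k%:R)^-1 * k%:R * 2 = 2^-1 :> R.
      by field; rewrite lt0r_neq0.
    lra.
  by rewrite /t invf_lt1; lra.
- rewrite card_ffun card_bool card_ord natrX mulrA ltr_pdivrMr ?expR_gt0 //.
  rewrite mulrCA mulrA [ltRHS]mulrC ltr_pM2r ?exprn_gt0 //.
  by rewrite [t * S]mulrC.
exists (\matrix_(i, j) (-1) ^+ v i j) => [i j|i i' ii'].
  by rewrite mxE normr_sign.
have := vP i i' (ltn_ord i) (ltn_ord i') ii'; rewrite /bad /= -leNgt.
by under [in X in _ -> X]eq_bigr do rewrite !mxE.
Qed.

Lemma powR_lt_expR (R : realType) (K c b : R) : 0 < b ->
  exists k0 : nat, forall k : nat, (k0 <= k)%N -> (0 < k)%N ->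
    K * k%:R `^ c < expR (k%:R `^ b / 2).
Proof.
move=> b0.
(* The Taylor term of order [N.+1] already dominates: [N] makes it grow at least like [k ^ (c + 1)],
   and the spare power of [k] absorbs [K] together with the denominator [D]. *)
pose N := Num.bound `|(c + 1) / b|.
have Nb : c + 1 <= N.+1%:R * b.
  rewrite -ler_pdivrMr // -natr1; apply: le_trans (ler_norm _) _.
  by have := archi_boundP (normr_ge0 ((c + 1) / b)); rewrite -/N; lra.
pose D : R := 2 ^+ N.+1 * N.+1`!%:R.
have D0 : 0 < D by rewrite mulr_gt0 ?exprn_gt0 ?ltr0n ?fact_gt0.
exists (Num.bound `|K * D|) => k kk0 k0.
have k1 : 1 <= k%:R :> R by rewrite ler1n.
have kc : 0 < k%:R `^ c :> R by rewrite powR_gt0 // ltr0n.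
have KD : K * D < k%:R.
  apply: le_lt_trans (ler_norm _) _.
  by apply: lt_le_trans (archi_boundP (normr_ge0 _)) _; rewrite ler_nat.
have y0 : 0 <= k%:R `^ b / 2 :> R by rewrite divr_ge0 ?powR_ge0.
have := expR_ge1Dxn N y0; apply: lt_le_trans.
rewrite expr_div_n -mulrA -invfM -/D.
have : k%:R `^ c * k%:R <= (k%:R `^ b) ^+ N.+1.
  rewrite -powR_mulrn ?powR_ge0 // -powRrM [b * _]mulrC.
  have -> : k%:R `^ c * k%:R = k%:R `^ (c + 1) :> R.
    by rewrite powRD ?powRr1 // pnatr_eq0 -lt0n k0 implybT.
  exact: ler_powR.
move=> h; apply: (@lt_le_trans _ _ (1 + k%:R `^ c * k%:R / D)); last first.
  by rewrite lerD2l ler_pM2r ?invr_gt0.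
have : K * k%:R `^ c <= k%:R `^ c * k%:R / D.
  by rewrite mulrC -mulrA ler_pM2l // ler_pdivlMr // ltW.
lra.
Qed.

(** * Failure of row selection *)

(** The witness is [H = 0]: every unselected row pays at least 1 in the identity block, for a total
    of at least [n / 2 > rho * n]. *)
Lemma row_selection_fails_half (R : realType) k n (rho : R) :
  (0 < n)%N -> 0 <= rho < 2^-1 -> row_selection_fails k n rho.
Proof.
move=> n0 /andP[rho0 rho2].
apply: (@row_selection_fails_witness R k n rho 0) => // f X injf.
apply: (@lt_le_trans _ _ (n%:R / 2 * 1)).
  by rewrite mulr1 mulrC ltr_pM2l ?ltr0n.
apply: span_cost_ge => // i _.
have : 0 <= \sum_a `|X i a| by exact: sumr_ge0.
have : 0 <= \sum_j `|(0 - X *m rowsub f 0 : 'M[R]_(n, k)) i j|.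
  exact: sumr_ge0.
lra.
Qed.

Lemma row_selection_fails_incoherent (R : realType) k n (rho S : R)
    (H : 'M[R]_(n, k)) :
  (0 < n)%N -> 0 <= rho -> 1 <= S -> (forall i j, `|H i j| = 1) ->
  (forall i i', i != i' -> `|\sum_j H i j * H i' j| <= S) ->
  2 * rho < k%:R / S -> row_selection_fails k n rho.
Proof.
move=> n0 rho0 S1 H1 HS rhoS.
apply: (row_selection_fails_witness (H := H)) => // f X injf.
apply: (@lt_le_trans _ _ (n%:R / 2 * (k%:R / S))).
  by rewrite -mulrA [rho * _]mulrC ltr_pM2l ?ltr0n //; lra.
apply: span_cost_ge => // [|i fi]; first by rewrite divr_ge0 // (le_trans _ S1).
by apply: incoherent_row_cost => // i'; exact: HS.
Qed.

Lemma row_selection_fails_large (R : realType) (c K alpha C : R) :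
  0 < alpha -> 0 < C -> exists k0 : nat,
    forall (k n : nat) (rho : R), (k0 <= k)%N -> (1 <= k)%N -> (1 <= n)%N ->
      n%:R <= K * k%:R `^ c -> 0 <= rho <= C * k%:R `^ (2^-1 - alpha) ->
      row_selection_fails k n rho.
Proof.
(* The slack [alpha] is halved: one half lifts [S] above [sqrt k], so that polynomially many rows
   fit; the other half beats the constant [2 * C]. *)
move=> alpha0 C0; pose b := alpha / 2; have b0 : 0 < b by rewrite divr_gt0.
have [k0 k0P] := powR_lt_expR (4 * K) c b0.
exists (maxn k0 (Num.bound ((2 * C) `^ b^-1))) => k n rho.
rewrite geq_max => /andP[kk0 kC] k1 n1 nK /andP[rho0 rhoC].
have k1R : 1 <= k%:R :> R by rewrite ler1n.
have kn0 : k%:R != 0 :> R by rewrite pnatr_eq0 -lt0n.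
pose S : R := k%:R `^ (2^-1 + b).
have S1 : 1 <= S by rewrite -[leLHS](powRr0 k%:R) ler_powR //; lra.
have sk : k%:R `^ 2^-1 = Num.sqrt k%:R :> R by rewrite powR12_sqrt.
have sk0 : 0 < Num.sqrt k%:R :> R by rewrite sqrtr_gt0 ltr0n.
have [|H H1 HS] := @incoherent_signs R k n S k1.
  have -> : S / (2 * Num.sqrt k%:R) = k%:R `^ b / 2.
    by rewrite /S powRD ?kn0 ?implybT // sk; field; rewrite lt0r_neq0.
  by apply: le_lt_trans (k0P k kk0 k1); rewrite -mulrA ler_pM2l.
apply: (row_selection_fails_incoherent n1 rho0 S1 H1 HS).
apply: (@le_lt_trans _ _ (2 * (C * k%:R `^ (2^-1 - alpha)))).
  by rewrite ler_pM2l.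
rewrite ltr_pdivlMr ?(lt_le_trans _ S1) //.
have kb : 2 * C < k%:R `^ b.
  have C20 : 0 <= 2 * C by rewrite mulr_ge0 // ltW.
  have -> : 2 * C = ((2 * C) `^ b^-1) `^ b.
    by rewrite -powRrM mulVf ?powRr1 // lt0r_neq0.
  apply: gt0_ltr_powR; rewrite ?nnegrE ?powR_ge0 //.
  apply: lt_le_trans (archi_boundP (powR_ge0 _ _)) _.
  by rewrite ler_nat.
(* The exponents add up to one: [b + (1/2 - alpha) + (1/2 + b) = 1]. *)
have kE : k%:R = k%:R `^ b * (k%:R `^ (2^-1 - alpha) * S) :> R.
  rewrite /S -!powRD ?kn0 ?implybT // -[LHS]powRr1 //; congr (_ `^ _).
  by rewrite /b; field.
rewrite [ltRHS]kE !mulrA ltr_pM2r ?(lt_le_trans _ S1) // ltr_pM2r //.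
by rewrite powR_gt0 // ltr0n.
Qed.

(** The factor [O(k^(1/2 - alpha))] is read in both ways: some constant serves all [k], and every
    constant serves all large [k]. *)
Theorem theoremG28 (R : realType) (c K alpha : R)
    (hc : 1 <= c) (hK : 0 < K) (halpha : 0 < alpha < 2^-1) :
  (exists2 C : R, 0 < C &
    forall k n : nat, (1 <= k)%N -> (1 <= n)%N -> n%:R <= K * k%:R `^ c ->
      row_selection_fails k n (C * k%:R `^ (2^-1 - alpha))) /\
  (forall C : R, 0 < C -> exists k0 : nat,
    forall k n : nat, (k0 <= k)%N -> (1 <= k)%N -> (1 <= n)%N ->
      n%:R <= K * k%:R `^ c ->
      row_selection_fails k n (C * k%:R `^ (2^-1 - alpha))).
Proof.
have /andP[alpha0 alpha2] := halpha.
have rate_ge0 (C : R) k : 0 < C -> 0 <= C * k%:R `^ (2^-1 - alpha).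
  by move=> C0; rewrite mulr_ge0 ?powR_ge0 // ltW.
split=> [|C C0]; last first.
  have [k0 k0P] := row_selection_fails_large c K alpha0 C0.
  by exists k0 => k n *; apply: k0P; rewrite ?rate_ge0 ?lexx.
have [k0 k0P] := row_selection_fails_large c K alpha0 (@ltr01 R).
have a0 : 0 <= 2^-1 - alpha by rewrite subr_ge0 ltW.
(* [D] bounds the rate for [k < k0], so the constant [4^-1 / D] keeps the factor at most 1/4 there;
   since [D >= 1], it is also below the constant 1 used for [k >= k0]. *)
pose D : R := k0.+1%:R `^ (2^-1 - alpha).
have D1 : 1 <= D by rewrite -[leLHS](powRr0 k0.+1%:R) ler_powR // ler1n.
have D0 : 0 < D by apply: lt_le_trans D1.
have C0 : 0 < 4^-1 / D by rewrite divr_gt0.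
exists (4^-1 / D) => // k n k1 n1 nK.
have [k0k|kk0] := leqP k0 k.
  apply: k0P; rewrite ?rate_ge0 //= ler_wpM2r ?powR_ge0 // ler_pdivrMr //.
  by rewrite mul1r; apply: le_trans D1; lra.
apply: row_selection_fails_half; rewrite // rate_ge0 //=.
apply: (@le_lt_trans _ _ 4^-1); last by lra.
rewrite mulrAC ler_pdivrMr // ler_pM2l // ge0_ler_powR ?nnegrE //.
by rewrite ler_nat ltnW // ltnS ltnW.
Qed.
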